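(* For every even integer $d\geq 6$ there exists a Salem number of degree $d$ with trace $0$ (i.e., the sum of its conjugates over $\mathbb{Q}$ equals $0$).
   Context: A Salem number is an algebraic integer $\alpha>1$ all of whose other conjugates over $\mathbb{Q}$ lie in the closed unit disc $|z|\le 1$, with at least one conjugate on the circle $|z|=1$. *)

(* Defs.v *)
From mathcomp Require Import all_boot all_order all_algebra all_field.

Set Implicit Arguments.
Unset Strict Implicit.
Unset Printing Implicit Defensive.

Import Order.TTheory GRing.Theory Num.Theory.
Local Open Scope ring_scope.

(* The conjugates of x over Q: the roots of its (monic) minimal polynomial,
   listed with multiplicity. As that polynomial is irreducible over Q, hence
   separable, each conjugate occurs exactly once. *)
Definition conjugates (x : algC) : seq algC :=
  sval (closed_field_poly_normal (minCpoly x)).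

Definition alg_degree (x : algC) : nat := (size (minCpoly x)).-1.

Definition alg_trace (x : algC) : algC := \sum_(z <- conjugates x) z.

(* The order of algC is partial: 1 < a also says that a is real. *)
Definition Salem_number (a : algC) : Prop :=
  [/\ a \in Aint,
      1 < a,
      forall z, z \in conjugates a -> z != a -> `|z| <= 1
    & exists2 z, z \in conjugates a & `|z| = 1].

(* Main.v *)
(** In the variable [y = x + 1/x], take integer polynomials [q_m] of degree [m]
    with [q_(m+1) = y q_m - q_(m-1)].  Interlacing is propagated by the
    recurrence, so [q_m] has [m - 1] simple roots in [(-2,2)] and one root above
    [2]; hence [p_m = x^m q_m(x + 1/x)] has all its roots on the unit circle but
    a real [a > 1] and [1/a], and its trace is that of [q_m], which is 0.

    Irreducibility.  The ideal [(q_m, q_(m-1))] and the polynomial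
    [q_m^2 - y q_m q_(m-1) + q_(m-1)^2 = c] do not depend on [m].  So if [k] is
    in that ideal and [t] is a root of [q_m], then [q_(m-1)(t)] divides [k(t)] in
    the ring of algebraic integers, and [q_(m-1)(t)^2 = c(t)].  For both families
    below, [k^4 (y^2-3)^2 (y+2)^4 (2-y) < c^2] on [(-2,2)], so the algebraic
    integer [(t^2-3)^2 (t+2)^4 (2-t) (k(t)/q_(m-1)(t))^4] would have all its
    conjugates in the open unit disc if no conjugate of [t] were greater than 2.
    This forces it to vanish, which is excluded by evaluating [q_m] at
    [sqrt 3] (and at [-1] when [k = y + 1]), where the recurrence is periodic.

    The family [q_2 = y^2 - y - 5], [q_3 = y^3 - 5 y - 3] works for
    [m <> 1 mod 6], and [q_2 = y^2 - 3], [q_3 = y^3 - 6 y - 5] for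
    [m = 1 mod 6]. *)

Require Import Defs.
From mathcomp Require Import all_boot all_order all_algebra all_field.
From mathcomp Require Import polyrcf ring lra zify.

Set Implicit Arguments.
Unset Strict Implicit.
Unset Printing Implicit Defensive.

Import Order.TTheory GRing.Theory Num.Theory.
Local Open Scope ring_scope.

(** * Second-order linear recurrences *)

(** The seeds move forward at each step, so that inductions generalize over them and shifted terms
    reduce by computation; [lrecSS] is the usual form. *)
Fixpoint lrec (R : pzRingType) (c d a b : R) (n : nat) : R :=
  if n is n'.+1 then lrec c d b (c * b - d * a) n' else a.

Lemma lrecSS (R : pzRingType) (c d a b : R) n :
  lrec c d a b n.+2 = c * lrec c d a b n.+1 - d * lrec c d a b n.
Proof. by elim: n a b => // n IHn a b; rewrite -[LHS]/(lrec c d b _ n.+2) IHn. Qed.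

Lemma rmorph_lrec (R S : pzRingType) (f : {rmorphism R -> S}) c d a b n :
  f (lrec c d a b n) = lrec (f c) (f d) (f a) (f b) n.
Proof.
by elim: n a b => //= n IHn a b; rewrite IHn rmorphB !rmorphM.
Qed.

(** * Interlacing of the roots *)

(** Interlacing is recorded by the signs of [q] at the roots of [p], the form in which the
    recurrence uses it. *)
Definition interlaced (R : realDomainType) k (p q : {poly R}) : Prop :=
  exists (r : 'I_k -> R) (rho : R),
  [/\ p = ('X - rho%:P) * \prod_i ('X - (r i)%:P), 2 < rho,
      forall i, -2 < r i < 2, forall i j : 'I_k, (i < j)%N -> r j < r i
    & forall i : 'I_k, 0 < (-1) ^+ i.+1 * q.[r i]].

Lemma prod_sign_gt0 (R : realDomainType) k (r : 'I_k -> R) j x :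
  (j <= k)%N -> (forall i : 'I_k, (i < j)%N -> x < r i) ->
  (forall i : 'I_k, (j <= i)%N -> r i < x) ->
  0 < (-1) ^+ j * \prod_i (x - r i).
Proof.
move=> le_jk ltx gtx.
have ->: (-1) ^+ j = \prod_(i < k) (if (i < j)%N then -1 else 1) :> R.
  by rewrite -big_mkcond /= (big_ord_narrow le_jk) prodr_const card_ord.
rewrite -big_split /=; apply: prodr_gt0 => i _.
case: ltnP => [/ltx | /gtx]; first by rewrite mulN1r opprB subr_gt0.
by rewrite mul1r subr_gt0.
Qed.

(* The new roots separate the points [2, r_0, ..., r_(k-1), -2], on which [s]
   alternates because [s = - q] at the roots of [p]. *)
Lemma interlaced_step (R : rcfType) k (p q : {poly R}) (s := 'X * p - q) :
    interlaced k p q -> s \is monic -> size s = k.+3 ->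
    s.[2] < 0 -> 0 < (-1) ^+ k * s.[-2] ->
  interlaced k.+1 s p.
Proof.
move=> [r [rho [Dp gt_rho itv_r dec_r sgn_q]]] mon_s sz_s s2 sN2.
(* The default [-2] of the failed [insub] supplies the last separating point [t k.+1]. *)
pose t j : R := if j is i.+1 then (if insub i is Some u then r u else -2) else 2.
have tS (i : 'I_k) : t i.+1 = r i by rewrite /t /= valK.
have tk : t k.+1 = -2 by rewrite /t /= insubF // ltnn.
have root_p i : p.[r i] = 0.
  by rewrite Dp hornerM horner_prod (bigD1 i) //= !hornerXsubC subrr mul0r mulr0.
have sgn_s j : (j <= k.+1)%N -> 0 < (-1) ^+ j.+1 * s.[t j].
  case: j => [_|j]; first by rewrite expr1 mulN1r oppr_gt0.
  rewrite ltnS leq_eqVlt => /predU1P[->|lt_jk].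
    by rewrite tk !exprS !mulN1r opprK.
  have Er : t j.+1 = r (Ordinal lt_jk) by rewrite -tS.
  have := sgn_q (Ordinal lt_jk).
  by rewrite Er /s !hornerE root_p mulr0 add0r [in X in _ -> X]exprS mulN1r mulrN mulNr opprK.
have dec_t j : (j <= k)%N -> t j.+1 < t j.
  case: j => [|j].
    case: (posnP k) => [k0 _ | k_gt0 _]; first by rewrite /t insubF ?k0 //; lra.
    by rewrite (tS (Ordinal k_gt0)); case/andP: (itv_r (Ordinal k_gt0)).
  move=> lt_jk; have ->: t j.+1 = r (Ordinal lt_jk) by rewrite -tS.
  have [Dk | lt_j1k] : j.+1 = k \/ (j.+1 < k)%N by lia.
    by rewrite Dk tk; case/andP: (itv_r (Ordinal lt_jk)).
  by have ->: t j.+2 = r (Ordinal lt_j1k); [rewrite -tS | exact: dec_r].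
have ltn_t i j : (i <= k.+1)%N -> (j < i)%N -> t i < t j.
  elim: i j => // i IHi j; rewrite ltnS => le_ik.
  rewrite ltnS leq_eqVlt => /predU1P[->|lt_ji]; first exact: dec_t.
  by apply: lt_trans (IHi j _ lt_ji); [exact: dec_t | exact: leqW].
have ex_x (j : 'I_k.+1) : exists x, t j.+1 < x < t j /\ root s x.
  have le_jk : (j <= k)%N by rewrite -ltnS.
  have [] := @poly_ivtoo _ s (t j.+1) (t j); first exact/ltW/dec_t.
    have := mulr_gt0 (sgn_s j (leqW le_jk)) (sgn_s j.+1 le_jk).
    rewrite [(-1) ^+ j.+2]exprS mulN1r mulNr mulrN mulrACA -expr2 sqrr_sign.
    by rewrite mul1r oppr_gt0 mulrC.
  by move=> x; rewrite in_itv /= => ? ?; exists x.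
have {ex_x} [x /all_and2[itv_x root_x]] := fin_all_exists ex_x.
have dec_x (i j : 'I_k.+1) : (i < j)%N -> x j < x i.
  move=> lt_ij; have [/andP[_ ltj] /andP[lti _]] := (itv_x j, itv_x i).
  apply: lt_trans ltj (le_lt_trans _ lti).
  move: lt_ij; rewrite leq_eqVlt => /predU1P[->|lt_i1j] //.
  by apply/ltW/ltn_t => //; exact/ltnW.
have itv2_x i : -2 < x i < 2.
  case/andP: (itv_x i) => lt1 lt2; apply/andP; split.
    apply: le_lt_trans lt1; case: (ltnP i k) => [lt_ik | le_ki].
      by rewrite -tk; apply/ltW/ltn_t.
    by have ->: i = k :> nat by [apply/anti_leq; rewrite le_ki -ltnS ltn_ord]; rewrite tk.
  apply: lt_le_trans lt2 _; case: {lt1} (nat_of_ord i) (ltn_ord i) => // j le_jk.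
  by apply: ltW; rewrite -[2]/(t 0%N); apply: ltn_t; rewrite // ltnW.
(* The [k.+1] roots found by sign changes leave a monic cofactor of degree 1, hence one more root
   [c], which [s.[2] < 0] then places beyond 2. *)
have [c Ds] : exists c, s = ('X - c%:P) * \prod_i ('X - (x i)%:P).
  have uniq_x: uniq [seq x i | i : 'I_k.+1].
    rewrite map_inj_uniq ?enum_uniq // => i j Dx; apply/val_inj/eqP => /=.
    by case: ltngtP => // /dec_x; rewrite Dx ltxx.
  have all_x : all (root s) [seq x i | i : 'I_k.+1].
    by apply/allP=> _ /mapP[i _ ->]; apply: root_x.
  have [u Du] := uniq_roots_prod_XsubC all_x (etrans (uniq_rootsE _) uniq_x).
  rewrite big_map big_enum /= in Du.
  set D := \prod_i _ in Du; have mon_D : D \is monic by apply: monic_prod_XsubC.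
  have mon_u : u \is monic by rewrite -(monicMr _ mon_D) -Du.
  have sz_D : size D = k.+2.
    by rewrite /D size_prod_XsubC /index_enum -enumT size_enum_ord.
  have sz_u : size u = 2.
    have: size s = (size u + k.+1)%N by rewrite Du size_Mmonic ?monic_neq0 // sz_D addnS.
    by rewrite sz_s; lia.
  exists (- u`_0); rewrite Du; congr (_ * _).
  apply/polyP=> i; rewrite coefB coefX coefC; case: i => [|[|i]] /=.
  - by rewrite sub0r opprK.
  - by move/monicP: mon_u; rewrite lead_coefE sz_u subr0.
  - by rewrite subrr nth_default ?sz_u.
exists x, c; split => //.
  move: s2; rewrite Ds hornerM hornerXsubC horner_prod.
  rewrite pmulr_llt0; first by rewrite subr_lt0.
  by apply: prodr_gt0 => i _; rewrite hornerXsubC subr_gt0; case/andP: (itv2_x i).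
(* At [x j] the factor of [rho] is negative, and so are exactly those of [r i] with [i < j]. *)
move=> j; have [/andP[lt1 lt2] /andP[_ lt3]] := (itv_x j, itv2_x j).
rewrite Dp hornerM hornerXsubC horner_prod exprS mulN1r mulNr -mulrN -mulNr mulrCA.
apply: mulr_gt0; first by rewrite opprB subr_gt0 (lt_trans _ gt_rho).
under eq_bigr do rewrite hornerXsubC.
apply: prod_sign_gt0 => [|i lt_ij|i le_ji]; first by rewrite -ltnS.
  rewrite -tS; apply: lt_le_trans lt2 _; move: lt_ij.
  rewrite leq_eqVlt => /predU1P[->|lt_i1j] //; apply/ltW/ltn_t => //.
  by rewrite ltnW // ltnW.
rewrite -tS; apply: le_lt_trans lt1; move: le_ji.
rewrite leq_eqVlt => /predU1P[->|lt_ji] //; apply/ltW/ltn_t => //.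
by rewrite ltnS ltnW.
Qed.

(** * Integrality of norms *)

Lemma horner_char_poly_det (R : comNzRingType) n (M : 'M[R]_n) x :
  (char_poly M).[x] = \det (x%:M - M).
Proof.
rewrite -horner_evalE -det_map_mx; congr (\det _).
by apply/matrixP=> i j; rewrite !mxE /= horner_evalE !hornerE; case: eqP; rewrite !hornerE.
Qed.

(** Splitting [f] rather than triangularizing [M]: each linear factor of [f] contributes a value of
    the characteristic polynomial, and the two products are exchanged. *)
Lemma det_horner_mx (F : closedFieldType) n (M : 'M[F]_n.+1) (f : {poly F}) rs :
  char_poly M = \prod_(x <- rs) ('X - x%:P) ->
  \det (horner_mx M f) = \prod_(x <- rs) f.[x].
Proof.
move=> char_M; have sz_rs : size rs = n.+1.
  by have := size_char_poly M; rewrite char_M size_prod_XsubC => -[].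
have [s ->] := closed_field_poly_normal f.
rewrite linearZ detZ rmorph_prod (big_morph _ (@det_mulmx F n.+1) (@det1 F n.+1)).
under [RHS]eq_bigr do rewrite hornerZ horner_prod.
rewrite big_split /= big_const_seq count_predT iter_mulr_1 sz_rs; congr (_ * _).
rewrite exchange_big; apply: eq_bigr => y _ /=.
rewrite rmorphB /= horner_mx_X horner_mx_C -opprB -scaleN1r detZ.
rewrite -horner_char_poly_det char_M horner_prod -sz_rs.
rewrite -iter_mulr_1 -(count_predT rs) -big_const_seq -big_split /=; apply: eq_bigr => x _.
by rewrite !hornerXsubC mulN1r opprB.
Qed.

(** This resultant is the determinant of [f] at the companion matrix of [p], which has integer
    entries. *)
Lemma int_prod_horner (p f : {poly int}) (rs : seq algC) :
    p \is monic -> map_poly intr p = \prod_(x <- rs) ('X - x%:P) ->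
  \prod_(x <- rs) (map_poly intr f).[x] \is a Num.int.
Proof.
move=> mon_p Dp.
have [rs0 | rs_gt0] := posnP (size rs).
  by rewrite (size0nil rs0) big_nil rpred1.
have [M charM] : exists M : 'M[int]_((size p).-1.-1.+1), char_poly M = p.
  have sz_p: size p = (size rs).+1.
    by rewrite -(size_prod_XsubC rs id) -Dp size_map_inj_poly //; apply: intr_inj.
  have ->: (size p).-1.-1.+1 = (size p).-1 by rewrite sz_p prednK.
  by exists (companionmx p); apply: companionmxK.
rewrite -(@det_horner_mx _ _ (map_mx intr M)); last by rewrite -map_char_poly charM.
by rewrite -map_horner_mx det_map_mx intr_int.
Qed.

(** * Minimal polynomials and conjugates *)

(** Write [p = h * q], a polynomial vanishing at [x]: if [h] vanished there, [p] would divide a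
    nonzero polynomial of smaller degree, so [q] vanishes there and [p] divides [q]. *)
Lemma irred_minCpoly (x y : algC) : root (minCpoly x) y -> minCpoly y = minCpoly x.
Proof.
have [p [Dp mon_p] dv_p] := minCpolyP x; have [q [Dq mon_q] dv_q] := minCpolyP y.
rewrite Dp Dq dv_q => /dvdpP[h Dh].
have /orP[p_h | p_q] : (p %| h) || (p %| q).
  by rewrite -!dv_p -rootM -rmorphM -Dh dv_p.
  have h0 : h != 0.
    apply: contraTneq mon_p => h0.
    by rewrite Dh h0 mul0r monicE lead_coef0 eq_sym oner_eq0.
  have := dvdp_leq h0 p_h; rewrite Dh size_Mmonic // => le_h.
  have := size_minCpoly y; rewrite Dq size_map_poly; move: le_h.
  by case: (size q) => [|[|n]] //; rewrite !addnS /= ltnNge leq_addr.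
have: p %= q by rewrite /eqp p_q /= {1}Dh dvdp_mulIr.
by rewrite eqp_monic // => /eqP->.
Qed.

Lemma minCpoly_int (x : algC) : x \in Aint ->
  exists2 p : {poly int}, p \is monic & minCpoly x = map_poly intr p.
Proof.
move=> /floorpP[p Dp]; exists p => //.
have:= minCpoly_monic x; rewrite Dp !monicE lead_coef_map_inj //; last exact: intr_inj.
by rewrite -(inj_eq (@intr_inj algC)).
Qed.

Lemma conjugatesE x : minCpoly x = \prod_(z <- conjugates x) ('X - z%:P).
Proof.
rewrite /conjugates; case: closed_field_poly_normal => s /= {1}->.
by rewrite (monicP (minCpoly_monic x)) scale1r.
Qed.

Lemma mem_conjugates x y : (y \in conjugates x) = root (minCpoly x) y.
Proof. by rewrite conjugatesE root_prod_XsubC. Qed.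

Lemma prod_norm_lt1 (s : seq algC) :
  (forall x, x \in s -> `|x| <= 1) -> (exists2 x, x \in s & `|x| < 1) ->
  `|\prod_(x <- s) x| < 1.
Proof.
move=> le1 [x0 s_x0 lt1]; rewrite (perm_big _ (perm_to_rem s_x0)) big_cons /= normrM.
have le_rem : `|\prod_(x <- rem x0 s) x| <= 1.
  rewrite normr_prod big_seq; apply: prodr_ile1 => x rem_x.
  by rewrite normr_ge0 le1 // (mem_rem rem_x).
exact: le_lt_trans (ler_piMr (normr_ge0 _) le_rem) lt1.
Qed.

(** The product of the values is a nonzero integer, so its modulus is at least 1, which leaves no
    room for a factor smaller than 1. *)
Lemma no_small_conjugates (z : algC) (f : {poly int}) (g := map_poly intr f : {poly algC}) :
    z \in Aint ->
    (forall x, x \in conjugates z -> g.[x] != 0 /\ `|g.[x]| <= 1) ->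
  forall x, x \in conjugates z -> `|g.[x]| = 1.
Proof.
move=> Az le1 y s_y; have [_ gy1] := le1 y s_y.
move: gy1; rewrite le_eqVlt => /predU1P[// | gy1].
have [p mon_p Dp] := minCpoly_int Az.
have Zn := int_prod_horner f mon_p (etrans (esym Dp) (conjugatesE z)).
have nz_n : \prod_(x <- conjugates z) g.[x] != 0.
  by rewrite prodf_seq_neq0; apply/allP=> x /le1[].
have lt1 : `|\prod_(x <- conjugates z) g.[x]| < 1.
  rewrite -(big_map (fun x => g.[x]) xpredT id); apply: prod_norm_lt1.
    by move=> _ /mapP[x s_x ->]; have [] := le1 x s_x.
  by exists g.[y]; first exact: map_f.
by have := le_lt_trans (norm_intr_ge1 Zn nz_n) lt1; rewrite ltxx.
Qed.

(** * Invariants and special values of the recurrence *)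

(** The characteristic polynomial has a double root here and for [c = -2]; the two cases give the
    values at the ends of the interval. *)
Lemma lrec_2 (R : comPzRingType) (a b : R) n : lrec 2 1 a b n = a + (b - a) *+ n.
Proof.
by elim: n a b => [|n IHn] a b /=; rewrite ?mulr0n ?addr0 // IHn mulrSr; ring.
Qed.

Lemma lrec_N2 (R : comPzRingType) (a : R) n : lrec (-2) 1 a (- a) n = (-1) ^+ n * a.
Proof.
elim: n a => [|n IHn] a /=; first by rewrite mul1r.
have -> : -2 * - a - 1 * a = - - a by ring.
by rewrite IHn exprS; ring.
Qed.

(** With [c = z + 1/z] and [d = 1], this passes from the recurrence of [q_m] to that of [p_m], whose
    coefficients are [z^2 + 1] and [z^2]. *)
Lemma lrec_scale (R : comPzRingType) (z c d a b : R) n :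
  lrec (z * c) (z ^+ 2 * d) a (z * b) n = z ^+ n * lrec c d a b n.
Proof.
elim: n {-2}n (leqnn n) => [|N IHN] [|[|n]] // le_nN; rewrite ?mul1r //.
rewrite !lrecSS !IHN; try lia.
by rewrite !exprS; ring.
Qed.

(** The map [(u, v) -> (c u - v, u)] preserves the form [u^2 - c u v + v^2]. *)
Lemma lrec_invariant (R : comPzRingType) (c a b : R) n :
  lrec c 1 a b n.+1 ^+ 2 - c * lrec c 1 a b n.+1 * lrec c 1 a b n
    + lrec c 1 a b n ^+ 2 = b ^+ 2 - c * b * a + a ^+ 2.
Proof. by elim: n => // n IHn; rewrite -IHn lrecSS; ring. Qed.

(** A step is unimodular, so any two consecutive terms generate the same ideal. *)
Lemma lrec_ideal (R : comPzRingType) (c a b k u v : R) n :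
    u * b + v * a = k ->
  exists u' v', u' * lrec c 1 a b n.+1 + v' * lrec c 1 a b n = k.
Proof.
move=> Dk; elim: n => [|n [u1 [v1 IHn]]]; first by exists u, v.
exists (- v1), (u1 + c * v1); rewrite lrecSS -[RHS]IHn; ring.
Qed.

(** The bound on [size d] keeps [d * a] below [c * b] in degree. *)
Lemma lrec_monic (R : nzRingType) (c d a b : {poly R}) m k n :
    c \is monic -> size c = m.+1 -> (0 < m)%N -> (size d <= m.*2)%N ->
    a \is monic -> size a = k.+1 -> b \is monic -> size b = (k + m).+1 ->
  (lrec c d a b n \is monic) && (size (lrec c d a b n) == (k + m * n).+1).
Proof.
move=> mon_c sz_c m_gt0 sz_d.
elim: n k a b => [|n IHn] k a b mon_a sz_a mon_b sz_b /=.
  by rewrite mon_a sz_a muln0 addn0 eqxx.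
have sz_cb : size (c * b) = (k + m + m).+1.
  by rewrite size_Mmonic ?monic_neq0 // sz_c sz_b; lia.
have sz_da : (size (- (d * a))%R < size (c * b)%R)%N.
  rewrite size_polyN sz_cb ltnS.
  apply: leq_trans (size_polyMleq _ _) _; rewrite sz_a addnS /=.
  by rewrite -addnA [leqRHS]addnC leq_add2r addnn.
rewrite mulnS addnA; apply: IHn => //; last by rewrite size_polyDl.
by rewrite monicE lead_coefDl // -monicE monicMr.
Qed.

(** The end conditions of [interlaced_step] persist: the values at 2 form a nonincreasing
    progression, negative from [q1] on, and those at -2 alternate between 1 and -1. *)
Lemma interlaced_lrec (R : rcfType) (q0 q1 : {poly R}) (q := lrec 'X 1 q0 q1) n :
    q0 \is monic -> size q0 = 3 -> q1 \is monic -> size q1 = 4 ->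
    q1.[2] < 0 -> q1.[2] <= q0.[2] -> q0.[-2] = 1 -> q1.[-2] = -1 ->
  interlaced 2 q1 q0 -> interlaced n.+2 (q n.+1) (q n).
Proof.
move=> mon0 sz0 mon1 sz1 lt2 le2 E0 E1 base.
have qE x m : (q m).[x] = lrec x 1 q0.[x] q1.[x] m.
  by rewrite -!horner_evalE rmorph_lrec /= !horner_evalE hornerX hornerC.
elim: n => // n IHn.
have Dq : q n.+2 = 'X * q n.+1 - q n by rewrite /q lrecSS mul1r.
have /andP[mon_q sz_q] : (q n.+2 \is monic) && (size (q n.+2) == (2 + 1 * n.+2).+1).
  by apply: lrec_monic; rewrite ?monicX ?size_polyX ?size_poly1 ?sz0.
rewrite Dq; apply: interlaced_step; rewrite -?Dq //.
- by rewrite (eqP sz_q) mul1n.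
- rewrite qE lrec_2 [_ *+ n.+2]mulrS addrA [_ + (_ - _)]addrC subrK.
  by apply: ltr_wnDr; rewrite // mulrn_wle0 // subr_le0.
- by rewrite qE E0 E1 lrec_N2 mulr1 -exprD addnn -signr_odd odd_double expr0.
Qed.

(** * The substitution [y = x + 1/x] and irreducibility *)

(** The roots of [X^2 - r X + 1] are complex conjugates, as its discriminant is negative; the last
    clause keeps [z] and [1/z] distinct. *)
Lemma circle_root (r : algC) : r \is Num.real -> -2 < r < 2 ->
  exists z : algC, [/\ z != 0, z + z^-1 = r, z^* = z^-1 & z^* != z].
Proof.
move=> Rr /andP[gtr ltr].
have lt0 : 0 < 4 - r ^+ 2.
  have -> : 4 - r ^+ 2 = (2 - r) * (r - -2) by ring.
  by rewrite mulr_gt0 // subr_gt0.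
pose s := sqrtC (4 - r ^+ 2); have s_gt0 : 0 < s by rewrite sqrtC_gt0.
have Ds : s ^+ 2 = 4 - r ^+ 2 by rewrite sqrtCK.
pose z := (r + 'i * s) / 2.
have Dz : z^* = (r - 'i * s) / 2.
  rewrite /z fmorph_div rmorphD rmorphM /= conjCi conjC_nat.
  by rewrite (CrealP Rr) (CrealP (gtr0_real s_gt0)) mulNr.
have zzc : z * z^* = 1.
  have -> : z * z^* = (r ^+ 2 - 'i ^+ 2 * s ^+ 2) / 4 by rewrite Dz /z; field.
  by rewrite sqrCi Ds; field.
have nz_z : z != 0 by have := oner_neq0 algC; rewrite -zzc mulf_eq0 negb_or => /andP[].
have Ez : z^* = z^-1 by apply: (mulfI nz_z); rewrite zzc divff.
exists z; rewrite -Ez; split=> //; first by rewrite Dz /z; field.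
rewrite Dz /z -subr_eq0.
have -> : (r - 'i * s) / 2 - (r + 'i * s) / 2 = - ('i * s) by field.
by rewrite oppr_eq0 mulf_neq0 ?neq0Ci // gt_eqF.
Qed.

Lemma exterior_root (r : algC) : 2 < r -> exists2 a : algC, 1 < a & a + a^-1 = r.
Proof.
move=> gtr; have r_gt0 : 0 < r by rewrite (lt_trans _ gtr).
pose s := sqrtC (r ^+ 2 - 4).
have s_ge0 : 0 <= s.
  rewrite sqrtC_ge0; have -> : r ^+ 2 - 4 = (r - 2) * (r + 2) by ring.
  by rewrite mulr_ge0 ?subr_ge0 ?addr_ge0 // ltW.
have Ds : s ^+ 2 = r ^+ 2 - 4 by rewrite sqrtCK.
have aa' : (r + s) / 2 * ((r - s) / 2) = 1.
  have -> : (r + s) / 2 * ((r - s) / 2) = (r ^+ 2 - s ^+ 2) / 4 by field.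
  by rewrite Ds; field.
have a_neq0 : (r + s) / 2 != 0.
  by apply/eqP=> a0; have := oner_neq0 algC; rewrite -aa' a0 mul0r eqxx.
exists ((r + s) / 2); first by rewrite ltr_pdivlMr // mul1r ltr_wpDr.
have -> : ((r + s) / 2)^-1 = (r - s) / 2 by apply: (mulfI a_neq0); rewrite aa' divff.
by field.
Qed.

(** This turns a small value of [f] at [z + 1/z] into an equally small value of [g] at [z] when [z]
    is on the unit circle. Each Horner step multiplies by [z (z + 1/z) = z^2 + 1]. *)
Lemma reciprocal_lift (f : {poly int}) : exists N (g : {poly int}), forall z : algC, z != 0 ->
  (map_poly intr g).[z] = z ^+ N * (map_poly intr f).[z + z^-1].
Proof.
elim/poly_ind: f => [|f c [N [g Dg]]].
  by exists 0%N, 0 => z _; rewrite !rmorph0 !horner0 mulr0.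
exists N.+1, (g * ('X^2 + 1) + c%:P * 'X^(N.+1)) => z nz_z.
rewrite !(rmorphD, rmorphM, rmorph1, rmorphXn) /= !map_polyX !map_polyC /=.
by rewrite !hornerE Dg // exprS; field.
Qed.

(* If [a] is not a conjugate of the root [z], then the norm of [1/a] or of [f(z)]
   is a nonzero integer of modulus less than 1. *)
Lemma minCpoly_salem (p f : {poly int}) (a : algC) (s : seq algC) :
    p \is monic -> 1 < a -> uniq [:: a, a^-1 & s] ->
    map_poly intr p = \prod_(x <- [:: a, a^-1 & s]) ('X - x%:P) ->
    (forall x, x \in s -> `|x| = 1) ->
    (forall x, x \in s -> 0 < `|(map_poly intr f).[x]| < 1) ->
  minCpoly a = map_poly intr p.
Proof.
move=> mon_p gt1 uniq_s Dp norm_s small_s; set rs := [:: a, a^-1 & s] in uniq_s Dp.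
pose pC : {poly algC} := map_poly intr p; pose pQ : {poly rat} := map_poly intr p.
have DpC : pC = map_poly ratr pQ.
  by rewrite -map_poly_comp; apply: eq_map_poly => c /=; rewrite rmorph_int.
have mon_pC : pC \is monic by apply: monic_map.
have root_p x : root pC x = (x \in rs) by rewrite /pC Dp root_prod_XsubC.
have a_gt0 : 0 < a := lt_trans ltr01 gt1.
have sub_rs z : z \in rs -> {subset conjugates z <= rs}.
  rewrite -root_p => pz0 x; rewrite mem_conjugates -root_p DpC.
  have [q [-> _] dv_q] := minCpolyP z.
  have /dvdpP[h ->] : q %| pQ by rewrite -dv_q -DpC.
  by rewrite rmorphM rootM orbC => ->.
have conj_a z : z \in rs -> a \in conjugates z.
  move=> rs_z; apply: contraT => not_a.
  have Az : z \in Aint.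
    apply: (@root_monic_Aint pC); rewrite ?root_p //.
    by apply/polyOverP=> i; rewrite coef_map intr_int.
  have sub_z x : x \in conjugates z -> x = a^-1 \/ x \in s.
    move=> z_x; move: (sub_rs z rs_z x z_x); rewrite !inE => /or3P[/eqP Dx|/eqP|]; auto.
    by rewrite Dx (negPf not_a) in z_x.
  have z_z : z \in conjugates z by rewrite mem_conjugates root_minCpoly.
  have lt_aV : `|a^-1| < 1 by rewrite normfV invf_lt1 gtr0_norm.
  (* If [1/a] is a conjugate of [z], the polynomial [X] gives the contradiction; otherwise all
     conjugates lie in [s] and [f] does. *)
  have [z_aV | not_aV] := boolP (a^-1 \in conjugates z).
    suffices: `|a^-1| = 1 by move=> E; rewrite E ltxx in lt_aV.
    rewrite -[a^-1]hornerX -(map_polyX intr); apply: no_small_conjugates Az _ _ z_aV.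
    move=> x /sub_z; rewrite map_polyX hornerX -normr_gt0 => -[->|/norm_s->] //.
    by rewrite (ltW lt_aV) normr_gt0 invr_eq0 gt_eqF.
  have sub_zs x : x \in conjugates z -> x \in s.
    by move=> z_x; case: (sub_z x z_x) => // Dx; rewrite -Dx z_x in not_aV.
  have /andP[_] := small_s z (sub_zs z z_z).
  rewrite (no_small_conjugates Az _ z_z) ?ltxx // => x /sub_zs/small_s/andP[gt0 lt1].
  by rewrite -normr_gt0 gt0 ltW.
(* All roots of [p] are conjugate to [a], and they are simple. *)
have dv_p : pC %| minCpoly a.
  rewrite /pC Dp uniq_roots_dvdp ?uniq_rootsE //; apply/allP=> z rs_z.
  have := conj_a z rs_z; rewrite mem_conjugates => /irred_minCpoly->.
  exact: root_minCpoly.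
apply/eqP; rewrite -eqp_monic ?minCpoly_monic // /eqp dv_p andbT.
have [q [-> _] dv_q] := minCpolyP a.
by rewrite -/pC DpC dvdp_map -dv_q -DpC root_p mem_head.
Qed.

(** * The reciprocal polynomials [p_m] *)

Lemma lrec_mull (R : comPzRingType) (x c d a b : R) n :
  lrec c d (x * a) (x * b) n = x * lrec c d a b n.
Proof.
by elim: n a b => //= n IHn a b; rewrite -IHn; congr lrec; ring.
Qed.

Lemma map_lrecX (R : comNzRingType) (q0 q1 : {poly int}) n :
  map_poly intr (lrec 'X 1 q0 q1 n)
    = lrec 'X 1 (map_poly intr q0) (map_poly intr q1) n :> {poly R}.
Proof. by rewrite rmorph_lrec /= map_polyX rmorph1. Qed.

Lemma horner_lrec (R : comNzRingType) (c d a b : {poly R}) x n :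
  (lrec c d a b n).[x] = lrec c.[x] d.[x] a.[x] b.[x] n.
Proof. by rewrite -!horner_evalE rmorph_lrec. Qed.

Lemma lrec_monic_X2D1 (p0 p1 : {poly int}) n :
    p0 \is monic -> size p0 = 5 -> p1 \is monic -> size p1 = 7 ->
  (lrec ('X^2 + 1) 'X^2 p0 p1 n \is monic)
    && (size (lrec ('X^2 + 1) 'X^2 p0 p1 n) == n.*2 + 5)%N.
Proof.
move=> mon0 sz0 mon1 sz1.
have -> : (n.*2 + 5 = (4 + 2 * n).+1)%N by lia.
have X2D1 : 'X^2 + 1 = 'X^2 - (-1)%:P :> {poly int} by rewrite polyCN opprK.
by apply: lrec_monic; rewrite ?size_polyXn ?X2D1 ?monicXnsubC ?size_XnsubC.
Qed.

(** The index is one below the degree. Multiplication by [X^2] shifts this coefficient, and the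
    other two terms of the recurrence have degree two less than the new one. The claim starts at
    [p1], since [p0] may have nonzero trace. *)
Lemma coef_subleading_lrec (p0 p1 : {poly int}) n :
    p0 \is monic -> size p0 = 5 -> p1 \is monic -> size p1 = 7 -> p1`_5 = 0 ->
  (lrec ('X^2 + 1) 'X^2 p0 p1 n.+1)`_(n.*2 + 5) = 0.
Proof.
move=> mon0 sz0 mon1 sz1 p15.
have sz_p m := (andP (lrec_monic_X2D1 m mon0 sz0 mon1 sz1)).2.
elim: n => // n IHn; rewrite lrecSS coefB mulrDl mul1r coefD !coefXnM.
have -> : (n.+1.*2 + 5 - 2 = n.*2 + 5)%N by lia.
have -> : (n.+1.*2 + 5 < 2)%N = false by lia.
rewrite IHn add0r.
by rewrite !nth_default ?subr0 // (eqP (sz_p _)); lia.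
Qed.

Lemma horner_lrec_recip (F : fieldType) (p0 p1 q0 q1 : {poly int}) (z : F) n :
    z != 0 -> (map_poly intr p0).[z] = z ^+ 2 * (map_poly intr q0).[z + z^-1] ->
    (map_poly intr p1).[z] = z ^+ 3 * (map_poly intr q1).[z + z^-1] ->
  (map_poly intr (lrec ('X^2 + 1) 'X^2 p0 p1 n)).[z]
    = z ^+ (n + 2) * (map_poly intr (lrec 'X 1 q0 q1 n)).[z + z^-1].
Proof.
move=> nz_z Dp0 Dp1; rewrite map_lrecX horner_lrec hornerX hornerC.
rewrite rmorph_lrec horner_lrec rmorphD rmorph1 /= map_polyXn hornerD hornerXn hornerC.
rewrite Dp0 Dp1 exprD -mulrA -lrec_mull -lrec_scale; congr lrec; rewrite ?mulr1 //.
  by field.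
by rewrite exprS mulrA.
Qed.

(** * The auxiliary polynomial and the Salem number *)

(** Here [b] stands for [q_(m-1)(t)] and [w] for [k(t)/b]; since [b^4 = c^2], the inequality divided
    by [b^4] is the upper bound. *)
Lemma aux_value_itv (R : realFieldType) (y b w k c : R)
    (e := (y ^+ 2 - 3) ^+ 2 * (y + 2) ^+ 4 * (2 - y)) :
    -2 < y < 2 -> w * b = k -> b ^+ 2 = c -> k != 0 -> y ^+ 2 != 3 ->
    k ^+ 4 * e < c ^+ 2 ->
  0 < e * w ^+ 4 < 1.
Proof.
case/andP=> gtN2 lt2 <- <- nz_k neq3 lt_kc.
have [w_neq0 b_neq0] : w != 0 /\ b != 0 by apply/andP; rewrite -negb_or -mulf_eq0.
have even4_gt0 (x : R) : x != 0 -> 0 < x ^+ 4.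
  by move=> nz_x; rewrite lt_def expf_neq0 // (exprM x 2 2) sqr_ge0.
have e_gt0 : 0 < e.
  have y2_gt0 : 0 < y + 2 by lra.
  have neq3_gt0 : 0 < (y ^+ 2 - 3) ^+ 2 by rewrite lt_def sqrf_eq0 subr_eq0 neq3 sqr_ge0.
  by rewrite /e pmulr_lgt0 ?subr_gt0 // pmulr_lgt0 ?even4_gt0 ?gt_eqF.
rewrite mulr_gt0 ?even4_gt0 //= -(ltr_pM2r (even4_gt0 _ b_neq0)) mul1r.
by rewrite -mulrA -exprMn mulrC (exprM b 2 2).
Qed.

(* Index shift: [q_m] is [lrec 'X 1 q0 q1 (m - 2)] and [p_m] likewise, and here
   [m = n + 3]. *)
Lemma salem_trace0_of_lrec (q0 q1 p0 p1 C k u v : {poly int}) n :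
    q0 \is monic -> size q0 = 3 -> q1 \is monic -> size q1 = 4 ->
    q1.[2] < 0 -> q1.[2] <= q0.[2] -> q0.[-2] = 1 -> q1.[-2] = -1 ->
    interlaced 2 (map_poly intr q1 : {poly algR}) (map_poly intr q0) ->
    p0 \is monic -> size p0 = 5 -> p1 \is monic -> size p1 = 7 -> p1`_5 = 0 ->
    (forall z : algC, z != 0 ->
      (map_poly intr p0).[z] = z ^+ 2 * (map_poly intr q0).[z + z^-1]) ->
    (forall z : algC, z != 0 ->
      (map_poly intr p1).[z] = z ^+ 3 * (map_poly intr q1).[z + z^-1]) ->
    q1 ^+ 2 - 'X * q1 * q0 + q0 ^+ 2 = C -> u * q1 + v * q0 = k ->
    (forall y : algR, -2 < y < 2 ->
      (map_poly intr k).[y] ^+ 4 * ((y ^+ 2 - 3) ^+ 2 * (y + 2) ^+ 4 * (2 - y))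
        < (map_poly intr C).[y] ^+ 2) ->
    (forall y : algR, root (map_poly intr (lrec 'X 1 q0 q1 n.+1)) y ->
      (y ^+ 2 != 3) && ((map_poly intr k).[y] != 0)) ->
  exists a : algC, [/\ Salem_number a, alg_degree a = (n + 3).*2 & alg_trace a = 0].
Proof.
move=> monq0 szq0 monq1 szq1 lt2 le2 E0 E1 base monp0 szp0 monp1 szp1 p15 Dp0 Dp1 DC Dk.
move=> small nz_roots.
pose qn := lrec 'X 1 q0 q1 n.+1; pose pn := lrec ('X^2 + 1) 'X^2 p0 p1 n.+1.
have intr_map (R : rcfType) (q : {poly int}) (x : int) :
  (map_poly intr q).[x%:~R] = (q.[x])%:~R :> R by rewrite horner_map.
have [r [rho [Dq gt_rho itv_r dec_r _]]] :
    interlaced n.+2 (map_poly intr qn : {poly algR}) (map_poly intr (lrec 'X 1 q0 q1 n)).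
  rewrite /qn !map_lrecX; apply: interlaced_lrec => //.
  - exact: monic_map.
  - by rewrite size_map_inj_poly //; apply: intr_inj.
  - exact: monic_map.
  - by rewrite size_map_inj_poly //; apply: intr_inj.
  - by rewrite (intr_map _ _ 2) ltrz0.
  - by rewrite !(intr_map _ _ 2) ler_int.
  - by rewrite (intr_map _ _ (-2)) E0.
  - by rewrite (intr_map _ _ (-2)) E1.
have algRmap (q : {poly int}) (y : algR) :
    (map_poly intr q).[algRval y] = algRval (map_poly intr q).[y].
  rewrite -horner_map -map_poly_comp; congr (_.[_]).
  by apply: eq_map_poly => c /=; rewrite rmorph_int.
have root_r i : root (map_poly intr qn) (r i).
  by rewrite rootE Dq hornerM horner_prod (bigD1 i) //= !hornerXsubC subrr mul0r mulr0.
have root_rho : root (map_poly intr qn) rho.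
  by rewrite rootE Dq hornerM hornerXsubC subrr mul0r.
have [f small_f] : exists f : {poly int}, forall y : algR,
    -2 < y < 2 -> root (map_poly intr qn) y -> 0 < `|(map_poly intr f).[y]| < 1.
  have [u' [v' Dk']] : exists u' v' : {poly int}, u' * qn + v' * lrec 'X 1 q0 q1 n = k.
    exact: lrec_ideal Dk.
  (* At a root of [qn], the cofactor [v'] takes the value of [k] divided by the preceding term. *)
  pose F : {poly int} := ('X^2 - 3%:P) ^+ 2 * ('X + 2%:P) ^+ 4 * (2%:P - 'X) * v' ^+ 4.
  exists F => y itv_y qy0.
  pose ev (q : {poly int}) := (map_poly intr q).[y].
  have evM p q : ev (p * q) = ev p * ev q by rewrite /ev rmorphM hornerM.
  have evD p q : ev (p + q) = ev p + ev q by rewrite /ev rmorphD hornerD.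
  have evB p q : ev (p - q) = ev p - ev q by rewrite /ev rmorphB hornerD hornerN.
  have evXn p m : ev (p ^+ m) = ev p ^+ m by rewrite /ev rmorphXn horner_exp.
  have evX : ev 'X = y by rewrite /ev map_polyX hornerX.
  have evC c : ev c%:P = c%:~R by rewrite /ev map_polyC hornerC.
  have evE := (evXn, evB, evD, evM, evX, evC).
  have qny0 : ev qn = 0 by apply/rootP.
  pose b := ev (lrec 'X 1 q0 q1 n).
  have Db : b ^+ 2 = ev C.
    have := congr1 ev (lrec_invariant 'X q0 q1 n).
    by rewrite -/qn DC !evE qny0 ?mulr0 ?mul0r expr0n /= subr0 add0r.
  have Dkb : ev v' * b = ev k by rewrite -Dk' !evE qny0 mulr0 add0r.
  have /andP[neq3 nz_k] := nz_roots y qy0.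
  have [G0 G1] := andP (aux_value_itv itv_y Dkb Db nz_k neq3 (small y itv_y)).
  change (0 < `|ev F| < 1); rewrite /F !evE.
  by rewrite gtr0_norm // G0.
have [a a_gt1 Da] := @exterior_root (algRval rho) gt_rho.
have ex_z i : exists z : algC, [/\ z != 0, z + z^-1 = algRval (r i), z^* = z^-1 & z^* != z].
  by apply: circle_root; [exact: algRvalP | exact: itv_r].
have {ex_z} [z /all_and4[nz_z Dz conj_z conj_neq]] := fin_all_exists ex_z.
have norm_z i : `|z i| = 1.
  by apply/eqP; rewrite -sqrp_eq1 // normCK conj_z divff.
have a_gt0 : 0 < a := lt_trans ltr01 a_gt1.
(* The numbers [z i + 1/(z i)] are distinct and no [z i] is its own inverse, so [s] has no
   repetition. *)
pose s := [seq z i | i : 'I_n.+2] ++ [seq (z i)^-1 | i : 'I_n.+2].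
have norm_s x : x \in s -> `|x| = 1.
  by rewrite mem_cat => /orP[] /mapP[i _ ->]; rewrite ?normfV norm_z ?invr1.
have trace_s x : x \in s -> exists2 i, x != 0 & x + x^-1 = algRval (r i).
  rewrite mem_cat => /orP[] /mapP[i _ ->]; exists i; rewrite ?invr_eq0 ?invrK //.
  by rewrite addrC.
have inj_r i j : algRval (r i) = algRval (r j) -> i = j.
  move/val_inj => Drij; apply/val_inj/eqP => /=.
  by case: ltngtP => // /dec_r; rewrite Drij ltxx.
have inj_z : injective z by move=> i j Dzij; apply: inj_r; rewrite -!Dz Dzij.
have uniq_zs : uniq s.
  rewrite cat_uniq map_inj_uniq ?enum_uniq //=.
  rewrite map_inj_uniq ?enum_uniq ?andbT //; last by move=> i j /invr_inj/inj_z.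
  apply/hasPn=> _ /mapP[i _ ->]; apply/negP=> /mapP[j _] Dzij.
  have ij : i = j by apply: inj_r; rewrite -!Dz -Dzij invrK addrC.
  by have := conj_neq i; rewrite conj_z Dzij ij eqxx.
have uniq_s : uniq [:: a, a^-1 & s].
  have notin_s x : 0 < x -> x != 1 -> x \notin s.
    by move=> x_gt0; apply: contra => /norm_s <-; rewrite gtr0_norm.
  have aV_neq : a != a^-1 by rewrite gt_eqF // (lt_trans _ a_gt1) // invf_lt1.
  rewrite !cons_uniq uniq_zs inE negb_or aV_neq !notin_s ?invr_gt0 ?invr_eq1 //.
    by rewrite gt_eqF.
  by rewrite gt_eqF.
have /andP[mon_p /eqP sz_p] := lrec_monic_X2D1 n.+1 monp0 szp0 monp1 szp1.
rewrite -/pn in mon_p sz_p.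
have sz_pC : size (map_poly intr pn : {poly algC}) = (n.+1.*2 + 5)%N.
  by rewrite size_map_inj_poly //; apply: intr_inj.
have sz_s : size s = n.+2.*2.
  by rewrite size_cat !size_map -!enumT size_enum_ord addnn.
(* These are [2 (n + 2) + 2] distinct roots, as many as the degree of [pn]. *)
have Dp : map_poly intr pn = \prod_(x <- [:: a, a^-1 & s]) ('X - x%:P) :> {poly algC}.
  have root_p x : x != 0 -> (map_poly intr qn).[x + x^-1] = 0 :> algC ->
      root (map_poly intr pn) x.
    move=> nz_x qx0; apply/rootP.
    by rewrite (@horner_lrec_recip _ p0 p1 q0 q1) ?Dp0 ?Dp1 // qx0 mulr0.
  rewrite [LHS](@all_roots_prod_XsubC _ _ [:: a, a^-1 & s]) ?uniq_rootsE //.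
  - by rewrite (monicP _) ?scale1r // monic_map.
  - by rewrite sz_pC -[size _]/(size s).+2 sz_s; clear; lia.
  - have rho_root : (map_poly intr qn).[algRval rho] = 0 :> algC.
      by rewrite algRmap (rootP root_rho).
    rewrite /= !root_p ?invr_eq0 ?gt_eqF ?invrK // ?(addrC a^-1) ?Da //=.
    apply/allP=> x /trace_s[i nz_x Dx]; apply: root_p => //.
    by rewrite Dx algRmap (rootP (root_r i)).
have [N [g Dg]] := reciprocal_lift f.
have min_a : minCpoly a = map_poly intr pn.
  apply: (@minCpoly_salem pn g a s) => // x s_x.
  have [i nz_x Dx] := trace_s x s_x.
  rewrite Dg // Dx normrM normrX norm_s // expr1n mul1r algRmap.
  exact: small_f.
have conj_a : perm_eq (conjugates a) [:: a, a^-1 & s].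
  by apply: prod_XsubC_eq; rewrite -conjugatesE min_a Dp.
exists a; split.
- split=> //.
  - apply: (@root_monic_Aint (minCpoly a)); rewrite ?root_minCpoly ?minCpoly_monic //.
    by rewrite min_a; apply/polyOverP=> i; rewrite coef_map intr_int.
  - move=> x; rewrite (perm_mem conj_a) !inE => /or3P[-> // | /eqP-> _ | /norm_s->//].
    by rewrite normfV invf_le1 gtr0_norm // ltW.
  - exists (z ord0); last exact: norm_z.
    by rewrite (perm_mem conj_a) !inE mem_cat map_f ?mem_enum ?orbT.
- by rewrite /alg_degree min_a sz_pC; clear; lia.
have sz_conj : size (conjugates a) = (n.*2 + 6)%N.
  by rewrite (perm_size conj_a) /= sz_s; clear; lia.
have Dsz : (size (conjugates a)).-1 = (n.*2 + 5)%N by rewrite sz_conj addnS.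
have nz_sz : size (conjugates a) != 0%N by rewrite sz_conj addnS.
(* The trace is minus the subleading coefficient of [pn]. *)
apply: oppr_inj; rewrite oppr0 -(coefPn_prod_XsubC nz_sz) Dsz -conjugatesE min_a.
by rewrite coef_map /= coef_subleading_lrec.
Qed.

(** * Polynomial inequalities on [[-2,2]] *)

(* A polynomial whose coefficients in this basis of degree [n] are positive is
   positive on [[l,r]]; given the basis, [lra] finds the coefficients. *)
Lemma bernstein_ge0 (R : realFieldType) (l r y : R) :
  l <= y <= r -> forall i j, 0 <= (y - l) ^+ i * (r - y) ^+ j.
Proof. by case/andP=> ly yr i j; rewrite mulr_ge0 ?exprn_ge0 ?subr_ge0. Qed.

Ltac bernstein_facts b i j :=
  let H := fresh in have H := b i j;
  lazymatch j with O => idtac | S ?j' => bernstein_facts b (S i) j' end.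

(** The polynomial [c] is [y + 2] times the quartic on the right. A common [(y + 2)^2] is divided
    out, which makes the inequality strict at -2 too. The difference has degree 8. *)
Lemma aux_bound_neq1 (R : realFieldType) (y : R) : -2 <= y <= 2 ->
  (y ^+ 2 - 3) ^+ 2 * (y + 2) ^+ 2 * (2 - y)
    < (y ^+ 4 - y ^+ 3 - 8 * y ^+ 2 + 4 * y + 17) ^+ 2.
Proof.
move=> /andP[ly yr].
have [y1|y1] := leP y (-(7/4)).
  have b := @bernstein_ge0 R (-2) (-(7/4)) y ltac:(lra).
  bernstein_facts b 0%N 8%N; lra.
have [y2|y2] := leP y (-(3/2)).
  have b := @bernstein_ge0 R (-(7/4)) (-(3/2)) y ltac:(lra).
  bernstein_facts b 0%N 8%N; lra.
have [y3|y3] := leP y (-1).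
  have b := @bernstein_ge0 R (-(3/2)) (-1) y ltac:(lra).
  bernstein_facts b 0%N 8%N; lra.
have [y4|y4] := leP y 0.
  have b := @bernstein_ge0 R (-1) 0 y ltac:(lra).
  bernstein_facts b 0%N 8%N; lra.
have b := @bernstein_ge0 R 0 2 y ltac:(lra).
bernstein_facts b 0%N 8%N; lra.
Qed.

(** Again [c] is [y + 2] times the cubic on the right and [(y + 2)^2] is divided out; the degree is
    11. *)
Lemma aux_bound_eq1 (R : realFieldType) (y : R) : -2 <= y <= 2 ->
  (y + 1) ^+ 4 * ((y ^+ 2 - 3) ^+ 2 * (y + 2) ^+ 2 * (2 - y))
    < (17 + 14 * y - y ^+ 2 - 2 * y ^+ 3) ^+ 2.
Proof.
move=> /andP[ly yr].
have [y1|y1] := leP y (-(3/2)).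
  have b := @bernstein_ge0 R (-2) (-(3/2)) y ltac:(lra).
  bernstein_facts b 0%N 11%N; lra.
have [y3|y3] := leP y (-1).
  have b := @bernstein_ge0 R (-(3/2)) (-1) y ltac:(lra).
  bernstein_facts b 0%N 11%N; lra.
have [y4|y4] := leP y 0.
  have b := @bernstein_ge0 R (-1) 0 y ltac:(lra).
  bernstein_facts b 0%N 11%N; lra.
have b := @bernstein_ge0 R 0 2 y ltac:(lra).
bernstein_facts b 0%N 11%N; lra.
Qed.

(** * The two families *)

(** The roots of [x + 1/x = y] are primitive 12th roots of unity, whose sixth power is -1; for
    [y = -1] they are primitive cube roots. *)
Lemma lrec_antiperiod (R : comPzRingType) (y a b : R) t j : y ^+ 2 = 3 ->
  lrec y 1 a b (6 * t + j) = (-1) ^+ t * lrec y 1 a b j.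
Proof.
move=> Dy; elim: t => [|t IHt]; first by rewrite mul1r.
rewrite exprS -mulrA -IHt -lrec_mull mulnS -addnA.
rewrite [LHS]/=; congr (lrec _ _ _ _ _).
  by ring: Dy.
by ring: Dy.
Qed.

Lemma lrec_period3 (R : comPzRingType) (a b : R) t j :
  lrec (-1) 1 a b (3 * t + j) = lrec (-1) 1 a b j.
Proof.
elim: t => // t IHt; rewrite -IHt mulnS -addnA [LHS]/=.
by congr (lrec _ _ _ _ _); ring.
Qed.

(** 21 is the discriminant of [y^2 - y - 5], which is [q_2] in the first family and divides [q_3] in
    the second. *)
Lemma ex_sqrt21 (R : rcfType) : exists w : R, w ^+ 2 = 21 /\ 4 < w < 5.
Proof.
exists (Num.sqrt 21); have w_ge0 := sqrtr_ge0 (21 : R).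
have Dw : Num.sqrt (21 : R) ^+ 2 = 21 by rewrite sqr_sqrtr.
by split=> //; move: w_ge0 Dw; set w := Num.sqrt _ => *; nra.
Qed.


Lemma Poly_monic (R : nzRingType) (s : seq R) : last 0 s = 1 -> Poly s \is monic.
Proof.
move=> lastE; have nz_s : last 0 s != 0 by rewrite lastE oner_neq0.
rewrite monicE lead_coefE (PolyK nz_s) -lastE nth_last //.
Qed.

Lemma size_Poly_last (R : nzSemiRingType) (s : seq R) :
  last 0 s != 0 -> size (Poly s) = size s.
Proof. by move/PolyK->. Qed.

Lemma lrec_root (R : comNzRingType) (q0 q1 : {poly int}) (y : R) n :
    root (map_poly intr (lrec 'X 1 q0 q1 n)) y ->
  lrec y 1 (map_poly intr q0).[y] (map_poly intr q1).[y] n = 0.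
Proof. by move/rootP; rewrite map_lrecX horner_lrec hornerX hornerC. Qed.

Lemma salem_trace0_mod6_neq1 n : (n.+1 %% 6 != 5)%N ->
  exists a : algC, [/\ Salem_number a, alg_degree a = (n + 3).*2 & alg_trace a = 0].
Proof.
move=> n_mod.
pose q0 : {poly int} := Poly [:: -5; -1; 1].
pose q1 : {poly int} := Poly [:: -3; -5; 0; 1].
have base : interlaced 2 (map_poly intr q1 : {poly algR}) (map_poly intr q0).
  (* Run backwards, the recurrence puts [3 - y^2] before [q0], so one interlacing step gives the
     base case. *)
  have Dq1 : map_poly intr q1 = 'X * map_poly intr q0 - Poly [:: 3; 0; -1] :> {poly algR}.
    by rewrite /q0 /q1 !map_Poly /= !cons_poly_def; ring.
  rewrite Dq1; apply: interlaced_step; rewrite -?Dq1.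
  - have [w [Dw /andP[w4 w5]]] := ex_sqrt21 algR.
    exists (fun=> (1 - w) / 2), ((1 + w) / 2); split.
    + rewrite big_ord1 map_Poly /= !cons_poly_def.
      have -> : (-5)%:~R = ((1 + w) / 2) * ((1 - w) / 2) :> algR by field: Dw.
      have -> : (-1)%:~R = - ((1 + w) / 2) - ((1 - w) / 2) :> algR by field.
      by rewrite !(rmorphM, rmorphB, rmorphN) /=; ring.
    + by rewrite ltr_pdivlMr //; lra.
    + by move=> _; lra.
    + by move=> i j; rewrite (ord1 i) (ord1 j).
    + by move=> i; rewrite (ord1 i) horner_Poly /=; nra.
  - by apply/monic_map/Poly_monic.
  - by rewrite size_map_inj_poly ?size_Poly_last //; apply: intr_inj.
  - by rewrite map_Poly horner_Poly /=; lra.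
  - by rewrite map_Poly horner_Poly /=; lra.
apply: (@salem_trace0_of_lrec q0 q1 (Poly [:: 1; -1; -3; -1; 1])
  (Poly [:: 1; 0; -2; -3; -2; 0; 1])
  (Poly [:: 34; 25; -12; -10; 1; 1]) 1 (3 - 'X) ('X^2 - 2 * 'X - 2)) => //;
  rewrite ?size_Poly_last ?horner_Poly //; try exact: Poly_monic.
- by rewrite (@PolyK _ 0).
- by move=> z nz_z; rewrite !map_Poly !horner_Poly /=; field.
- by move=> z nz_z; rewrite !map_Poly !horner_Poly /=; field.
- by rewrite /q0 /q1 /= !cons_poly_def; ring.
- by rewrite /q0 /q1 /= !cons_poly_def; ring.
- move=> y /andP[gtN2 lt2].
  rewrite rmorph1 hornerC map_Poly horner_Poly /= expr1n mul1r.
  have y2_gt0 : 0 < (y + 2) ^+ 2 by rewrite exprn_gt0 //; lra.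
  have := @aux_bound_neq1 _ y; rewrite !ltW // => /(_ isT); rewrite -(ltr_pM2l y2_gt0).
  by congr (_ < _); ring.
- move=> y /lrec_root; rewrite rmorph1 hornerC oner_neq0 andbT => un0.
  apply/negP=> /eqP Dy; have Dy3 : y ^+ 3 = 3 * y by ring: Dy.
  have Dy4 : y ^+ 4 = 9 by ring: Dy.
  have [neq2 neq32] : y <> -2 /\ y <> -(3 / 2).
    by split=> Ey; move: Dy; rewrite Ey; lra.
  move: un0; rewrite (divn_eq n.+1 6) mulnC lrec_antiperiod //.
  have -> : (map_poly intr q0).[y] = -2 - y.
    by rewrite map_Poly horner_Poly /=; ring: Dy.
  have -> : (map_poly intr q1).[y] = - 2 * y - 3.
    by rewrite map_Poly horner_Poly /=; ring: Dy.
  move/eqP; rewrite mulf_eq0 signr_eq0 /=.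
  (* The terms of index 0 to 4 are multiples of [y + 2] or [2 y + 3]; that of index 5 is 0, hence
     the excluded residue. *)
  case: (_ %% 6)%N (ltn_mod n.+1 6) n_mod => [|[|[|[|[|[|//]]]]]] //= _ _ /eqP Ey.
  + by apply: neq2; lra.
  + by apply: neq32; lra.
  + by apply: neq2; lra.
  + by apply: neq32; lra.
  + by apply: neq2; lra.
Qed.

Lemma salem_trace0_mod6_eq1 n : (n.+1 %% 6 = 5)%N ->
  exists a : algC, [/\ Salem_number a, alg_degree a = (n + 3).*2 & alg_trace a = 0].
Proof.
move=> n_mod.
pose q0 : {poly int} := Poly [:: -3; 0; 1].
pose q1 : {poly int} := Poly [:: -5; -6; 0; 1].
have base : interlaced 2 (map_poly intr q1 : {poly algR}) (map_poly intr q0).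
  have [w [Dw /andP[w4 w5]]] := ex_sqrt21 algR.
  (* From [y^3 - 6 y - 5 = (y + 1)(y^2 - y - 5)]. *)
  exists (fun i => if i == ord0 then -1 else (1 - w) / 2), ((1 + w) / 2); split.
  - rewrite big_ord_recl big_ord1 map_Poly /= !cons_poly_def.
    have -> : (-5)%:~R = ((1 + w) / 2) * ((1 - w) / 2) :> algR by field: Dw.
    have -> : (-6)%:~R = ((1 + w) / 2) * ((1 - w) / 2) - 1 :> algR by field: Dw.
    have -> : (1 - w) / 2 = 1 - (1 + w) / 2 :> algR by field.
    by rewrite !(rmorphM, rmorphB, rmorphN) /=; ring.
  - by rewrite ltr_pdivlMr //; lra.
  - by move=> i; case: ifP => _; lra.
  - by move=> [[|[|//]] ?] [[|[|//]] ?] //= _; lra.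
  - by case=> [[|[|//]] ?]; rewrite /q0 map_Poly horner_Poly /=; nra.
(* Both seeds are even at -1, so 1 is not in their ideal; [y + 1] is. *)
apply: (@salem_trace0_of_lrec q0 q1 (Poly [:: 1; 0; -1; 0; 1])
  (Poly [:: 1; 0; -3; -5; -3; 0; 1])
  (Poly [:: 34; 45; 12; -5; -2]) ('X + 1) ('X - 2) (2 * 'X - 'X^2 + 3)) => //;
  rewrite ?size_Poly_last ?horner_Poly //; try exact: Poly_monic.
- by rewrite (@PolyK _ 0).
- by move=> z nz_z; rewrite !map_Poly !horner_Poly /=; field.
- by move=> z nz_z; rewrite !map_Poly !horner_Poly /=; field.
- by rewrite /q0 /q1 /= !cons_poly_def; ring.
- by rewrite /q0 /q1 /= !cons_poly_def; ring.
- move=> y /andP[gtN2 lt2].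
  rewrite map_Poly horner_Poly rmorphD rmorph1 /= map_polyX hornerD hornerX hornerC.
  have y2_gt0 : 0 < (y + 2) ^+ 2 by rewrite exprn_gt0 //; lra.
  have := @aux_bound_eq1 _ y; rewrite !ltW // => /(_ isT); rewrite -(ltr_pM2l y2_gt0).
  by congr (_ < _); ring.
move=> y /lrec_root; rewrite (divn_eq n.+1 6) n_mod mulnC => un0.
rewrite rmorphD rmorph1 /= map_polyX hornerD hornerX hornerC.
apply/andP; split; apply/negP=> /eqP Dy.
  move: un0; rewrite lrec_antiperiod // => /eqP; rewrite mulf_eq0 signr_eq0 /=.
  have -> : (map_poly intr q0).[y] = 0 by rewrite map_Poly horner_Poly /=; ring: Dy.
  have -> : (map_poly intr q1).[y] = - 3 * y - 5.
    by rewrite map_Poly horner_Poly /=; ring: Dy.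
  move=> /eqP Ey; have Dy3 : y ^+ 3 = 3 * y by ring: Dy.
  have Dy4 : y ^+ 4 = 9 by ring: Dy.
  have Dy5 : y ^+ 5 = 9 * y by ring: Dy.
  have yE : y = -(5 / 3) by lra.
  by move: Dy; rewrite yE; lra.
(* At -1 the seeds are -2 and 0, and an index congruent to 2 modulo 3 gives the value 2. *)
have {Dy} Dy : y = -1 by lra.
move: un0; rewrite Dy -[(6 * _ + 5)%N]/(3 * 2 * _ + 5)%N -mulnA lrec_period3.
by rewrite !map_Poly !horner_Poly /=; lra.
Qed.

Unset Implicit Arguments.

Theorem theorem1p3 (d : nat) (hd : (6 <= d)%N) (d_even : ~~ odd d) :
  exists a : algC,
    [/\ Salem_number a, alg_degree a = d & alg_trace a = 0].
Proof.
have -> : d = (d./2 - 3 + 3).*2 by lia.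
have [n_mod | n_mod] := eqVneq ((d./2 - 3).+1 %% 6)%N 5; first exact: salem_trace0_mod6_eq1.
exact: salem_trace0_mod6_neq1.
Qed.
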